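(* Let $p$ be a prime and let $k,n\geq 1$ and $s\geq 0$ be integers such that $k=\frac{p^{s+1}-1}{p-1}$. Let $R=\mathbb{Z}/p^k\mathbb{Z}$ and let $A(p^k,n)$ be the point–hyperplane incidence matrix over $R^n$ defined in the context. Then $$\operatorname{rank}_p\big(A(p^k,n)\big)\leq \frac{p^{kn}}{k^{n-1}}\left(1-\frac{1}{p}\right)^{-n}.$$
   Context: $R=\mathbb{Z}/p^k\mathbb{Z}$. The projective space $\mathbb{P}(R)^{n-1}$ is the set of vectors $v\in R^n$ having at least one coordinate that is a unit of $R$, modulo the equivalence $v\sim u$ if $v=cu$ for a unit $c\in R$; fix one representative in $R^n$ for each class (e.g. the one whose first unit coordinate equals $1$), so $\mathbb{P}(R)^{n-1}\subset R^n$. For $u,v\in R^n$, $\langle u,v\rangle=\sum_{i=1}^n u_iv_i \bmod p^k$. For $b\in\mathbb{P}(R)^{n-1}$ and $\lambda\in R$, the hyperplane is $H_{b,\lambda}=\{v\in R^n:\langle v,b\rangle=\lambda\}$. The matrix $A(p^k,n)$ has rows indexed by $\mathbb{P}(R)^{n-1}\times R$ and columns indexed by $R^n$, with entry in position $((b,\lambda),v)$ equal to $1$ if $\langle b,v\rangle=\lambda$ and $0$ otherwise. For an integer matrix $M$, $\operatorname{rank}_p(M)$ denotes the rank of $M$ reduced modulo $p$, over the field $\mathbb{F}_p$. *)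

(* Defs.v *)
From HB Require Import structures.
From mathcomp Require Import all_boot all_order all_algebra.
Set Implicit Arguments.
Unset Strict Implicit.
Unset Printing Implicit Defensive.
Import Order.TTheory GRing.Theory Num.Theory.
Local Open Scope ring_scope.

Definition inner (R : finComUnitRingType) (n : nat) (u v : 'rV[R]_n) : R :=
  \sum_i u 0 i * v 0 i.

Definition has_unit_coord (R : finComUnitRingType) (n : nat) : {set 'rV[R]_n} :=
  [set v : 'rV[R]_n | [exists i, v 0 i \is a GRing.unit]].

Definition proj_equiv (R : finComUnitRingType) (n : nat) : rel 'rV[R]_n :=
  fun v u => [exists c : R, (c \is a GRing.unit) && (v == c *: u)].

Definition proj_classes (R : finComUnitRingType) (n : nat) :
    {set {set 'rV[R]_n}} :=
  equivalence_partition (@proj_equiv R n) (has_unit_coord R n).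

(* [P] contains exactly one vector of each projective class; the projective
   space is represented in R^n by an arbitrary such [P]. *)
Definition proj_representatives (R : finComUnitRingType) (n : nat)
    (P : {set 'rV[R]_n}) : bool :=
  is_transversal P (proj_classes R n) (has_unit_coord R n).

(* Rows and columns are numbered through the enumerations of P x R and R^n;
   the numbering does not affect the rank. *)
Definition incidence_mx (R : finComUnitRingType) (n : nat)
    (P : {set 'rV[R]_n}) :
    'M[int]_(#|setX P [set: R]|, #|[set: 'rV[R]_n]|) :=
  \matrix_(r, c)
    (let bl := enum_val r in (inner bl.1 (enum_val c) == bl.2)%:R).

Definition rank_mod (p m n : nat) (M : 'M[int]_(m, n)) : nat :=
  \rank (map_mx (fun z : int => z%:~R : 'F_p) M).

Lemma proj_equiv_equivalence (R : finComUnitRingType) (n : nat) :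
  equivalence_rel (@proj_equiv R n).
Proof.
move=> x y z; split.
  by apply/existsP; exists 1; rewrite unitr1 scale1r eqxx.
case/existsP=> c /andP[cU /eqP->]; apply/existsP/existsP.
  case=> d /andP[dU /eqP dE]; exists (c^-1 * d).
  by rewrite unitrM unitrV cU dU -scalerA -dE scalerA mulVr // scale1r eqxx.
case=> d /andP[dU /eqP->]; exists (c * d).
by rewrite unitrM cU dU scalerA eqxx.
Qed.

Lemma proj_representatives_exist (R : finComUnitRingType) (n : nat) :
  exists P : {set 'rV[R]_n}, proj_representatives P.
Proof.
exists (transversal (proj_classes R n) (has_unit_coord R n)).
apply: transversalP; apply: equivalence_partitionP => x y z _ _ _.
exact: proj_equiv_equivalence.
Qed.

(* Main.v *)
Require Import Defs.
From HB Require Import structures.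
From mathcomp Require Import all_boot all_order all_algebra all_field.
From mathcomp Require Import zify ring.
Import Order.TTheory GRing.Theory Num.Theory.
Local Open Scope ring_scope.

(* Say that S in R^n is a Kakeya set if it contains a line {a_b + t b} in every
   direction b with a unit coordinate.  Such a set has at least rank_p(A)
   points: for a primitive p^k-th root of unity z, summing over the line gives
     p^k z^<a_b,u> [<b,u> = l] = sum_t z^(-t l) z^<a_b + t b,u>,
   so the matrix with entries z^<a_b,u> [<b,u> = l] factors through S, and it
   becomes A modulo p when z is specialized to 1, which cannot increase the rank
   because 1 - z is nilpotent modulo p.

   A small Kakeya set is made of the lines through (0, a(c_2), ..., a(c_n)) in
   direction (1, c_2, ..., c_n) and its analogues for the other positions of the
   first unit coordinate.  With c = sum_j c_j p^j and a(c) = sum_j m_j c_j p^j,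
   the value a(c) + t c = sum_j (m_j + t) c_j p^j depends modulo p^M on only
   M - s digits when (m_(M-i) + t) is divisible by p^i for 1 <= i <= s.  A
   sequence m with such an M for every t is given by the postorder traversal of
   the p-ary tree of residues modulo p, p^2, ..., p^s, whose p + ... + p^s = k - 1
   nodes are assigned to the digits 1, ..., k - 1. *)

(** * Base-[p] digits and their multipliers *)

(** Induction on the height [h]. The block with index [a] has length [N.+1]: a copy [a + p * m] of
    the previous sequence, then the root [a]. Choosing [a < p] with [p] dividing [a + t] leaves the
    previous problem for [t' = (a + t) / p]. *)
Lemma multiplier_sequence (p h : nat) : (0 < p)%N ->
  exists m : nat -> nat, forall t : nat,
    exists2 j0, (j0 + h <= \sum_(i < h) p ^ i.+1)%N &
      forall i, (i < h)%N -> (p ^ (h - i) %| m (j0 + i) + t)%N.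
Proof.
move=> p_gt0; elim: h => [|h [m mP]].
  by exists id => t; exists 0%N; rewrite ?big_ord0.
set N := (\sum_(i < h) p ^ i.+1)%N in mP.
exists (fun j => (if j %% N.+1 < N then j %/ N.+1 + p * m (j %% N.+1)
                  else j %/ N.+1)%N) => t.
have [a ap /dvdnP[t' tE]] : exists2 a, (a < p)%N & (p %| a + t)%N.
  exists ((p - t %% p) %% p)%N; first by rewrite ltn_pmod.
  rewrite /dvdn modnDml -modnDmr subnK ?modnn //.
  by rewrite ltnW // ltn_pmod.
have [j0 j0h j0P] := mP t'.
have NE : (\sum_(i < h.+1) p ^ i.+1 = p * N.+1)%N.
  rewrite big_ord_recl /= expn1 mulnS /N big_distrr /=.
  by congr (_ + _)%N; apply: eq_bigr => i _; rewrite -expnS.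
exists (a * N.+1 + j0)%N.
  rewrite NE; apply: (@leq_trans (a.+1 * N.+1)); last by rewrite leq_mul.
  by rewrite mulSn; lia.
(* At offset [h] only one factor [p] is required, so that position may be the root of the block or
   still lie inside the copy. *)
move=> i; rewrite ltnS leq_eqVlt => /predU1P[->|ih].
  rewrite subSnn expn1 -addnA modnMDl divnMDl // modn_small ?divn_small; try lia.
  rewrite addn0; case: ifP => _; last by rewrite tE dvdn_mull.
  by rewrite addnAC tE; apply: dvdn_add; [apply: dvdn_mull | apply: dvdn_mulr].
rewrite -addnA modnMDl divnMDl // modn_small ?divn_small; try lia.
rewrite (_ : j0 + i < N)%N; last by lia.
rewrite addn0 addnAC tE mulnC -mulnDr subSn ?expnS; last by lia.
by rewrite dvdn_pmul2l // addnC j0P.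
Qed.

Lemma digit_expansion (p k c : nat) : (0 < p)%N -> (c < p ^ k)%N ->
  (\sum_(j < k) (c %/ p ^ j %% p) * p ^ j = c)%N.
Proof.
move=> p_gt0 ck; rewrite -[RHS](modn_small ck) {ck}; elim: k => [|k IH].
  by rewrite big_ord0 modn1.
rewrite big_ord_recr /= IH [in RHS](divn_eq c (p ^ k)).
rewrite {2}(divn_eq (c %/ p ^ k) p) mulnDl -mulnA -expnS -addnA modnMDl.
rewrite [RHS]modn_small 1?addnC //.
rewrite (@leq_trans ((c %/ p ^ k %% p).+1 * p ^ k)) //.
  by have := @ltn_pmod c (p ^ k); rewrite expn_gt0 p_gt0 mulSn; lia.
by rewrite expnS leq_mul2r ltn_pmod ?orbT.
Qed.

Lemma digit_modn (p j l c : nat) : (j < l)%N ->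
  ((c %% p ^ l) %/ p ^ j = c %/ p ^ j %[mod p])%N.
Proof. by move=> jl; rewrite !modn_divl -expnS modn_dvdm // dvdn_exp2l. Qed.

Lemma slope_function (p k s : nat) : prime p ->
  k = (\sum_(i < s) p ^ i.+1).+1 ->
  exists a : nat -> nat, forall t : nat, exists2 j0, (0 < j0 /\ j0 + s <= k)%N &
    exists G : nat -> nat, forall c, (c < p ^ k)%N ->
      (a c + t * c = G (c %% p ^ j0) %[mod p ^ (j0 + s)])%N.
Proof.
move=> p_prime kE; have p_gt0 := prime_gt0 p_prime.
have [m mP] := multiplier_sequence p s p_gt0.
pose d c j := (c %/ p ^ j %% p)%N.
exists (fun c => \sum_(j < k) m j.-1 * (d c j * p ^ j))%N => t.
have [i0 i0s i0P] := mP t.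
(* Multipliers start at digit 1; digit 0 reuses [m 0] and always lies below the cut [i0.+1], where
   no divisibility is asked. *)
exists i0.+1; first by split=> //; rewrite kE addSn ltnS.
exists (fun x => \sum_(j < i0.+1) (m j.-1 + t) * (d x j * p ^ j))%N => c ck.
rewrite -{2}(digit_expansion p k c) // big_distrr -big_split /=.
under eq_bigr => j _ do rewrite -mulnDl -/(d c j).
rewrite -(big_mkord xpredT (fun j => (m j.-1 + t) * (d c j * p ^ j)))%N.
rewrite (@big_cat_nat _ _ _ i0.+1) //=; last by rewrite kE; lia.
rewrite big_mkord.
under [in RHS]eq_bigr => j _ do rewrite /d digit_modn // -/(d c j).
rewrite -[in RHS](addn0 (\sum_(j < _) _))%N; apply/eqP; rewrite eqn_modDl mod0n.
rewrite big_nat; apply: dvdn_sum => j /andP[ij jk].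
(* Digits from [i0.+1 + s] on vanish by their weight [p ^ j]; for the [s] digits before them the
   multiplier supplies the missing power of [p]. *)
have [js|sj] := ltnP j (i0.+1 + s); last first.
  by rewrite dvdn_mull // dvdn_mull // dvdn_exp2l.
have jE : (j = (i0 + (j - i0.+1)).+1)%N by lia.
have := i0P (j - i0.+1)%N; rewrite [in X in (_ < X)%N -> _]/= => /(_ ltac:(lia)).
move=> dv; rewrite [in m _]jE /= mulnCA dvdn_mull //.
rewrite (_ : i0.+1 + s = s - (j - i0.+1) + j)%N; last by lia.
by rewrite expnD; apply: dvdn_mul.
Qed.

(** * Specializing a root of unity to 1 modulo [p] *)

Lemma polyint_eq0_modp (p : nat) (f : {poly int}) : prime p ->
  map_poly (intr : int -> 'F_p) f = 0 -> exists g : {poly int}, f = p%:Z *: g.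
Proof.
move=> p_prime f0; exists (\poly_(i < size f) (f`_i %/ p%:Z)%Z).
apply/polyP => i; rewrite coefZ coef_poly; case: ltnP => [_|sf]; last first.
  by rewrite mulr0 nth_default.
have /(congr1 (fun h : {poly 'F_p} => h`_i)) := f0.
rewrite coef_map coef0 => fi0; rewrite mulrC divzK //.
by rewrite (dvdz_pcharf (pchar_Fp p_prime)) fi0.
Qed.

(** Write [f - f(1) = g * (X - 1)], evaluate at [z] and raise to the power [q = p ^ k]. Since
    [(X - 1)^q] is [X^q - 1] plus [p] times some [e], this gives [(- f(1))^q = p * e(z) * g(z)^q].
    The cofactor of [p] is a rational algebraic integer, hence an integer. *)
Lemma horner1_eq0_of_root_unity (p k : nat) (z : algC) (f : {poly int}) : prime p ->
  z ^+ (p ^ k) = 1 -> root (map_poly intr f) z -> (f.[1])%:~R = 0 :> 'F_p.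
Proof.
move=> p_prime zq fz; set q := (p ^ k)%N.
have [e eE] : exists e : {poly int}, ('X - 1) ^+ q - ('X^q - 1) = p%:Z *: e.
  apply: polyint_eq0_modp => //.
  rewrite rmorphB rmorphXn !rmorphB /= map_polyX map_polyXn rmorph1.
  have charpP : p \in [pchar {poly 'F_p}] by rewrite pchar_poly pchar_Fp.
  have -> : ('X - 1 : {poly 'F_p}) ^+ q = 'X^q - 1.
    rewrite /q; elim: k {zq q} => [|k IH]; first by rewrite expn0.
    rewrite expnSr !exprM IH -!(pFrobenius_autE charpP).
    by rewrite pFrobenius_autB_comm ?pFrobenius_aut1 //; apply: commr1.
  by rewrite subrr.
have [g gE] : exists g, f - f.[1]%:P = g * ('X - 1).
  by apply/factor_theorem; rewrite /root !hornerE subrr.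
pose ev (h : {poly int}) : algC := (map_poly intr h).[z].
have evM h1 h2 : ev (h1 * h2) = ev h1 * ev h2 by rewrite /ev rmorphM hornerM.
have evB h1 h2 : ev (h1 - h2) = ev h1 - ev h2 by rewrite /ev rmorphB !hornerE.
have evX h n : ev (h ^+ n) = ev h ^+ n by rewrite /ev rmorphXn horner_exp.
have q_gt0 : (0 < q)%N by rewrite expn_gt0 prime_gt0.
have zA : z \in Aint.
  by apply: (@Aint_unity_root q) => //; apply/unity_rootP.
have evA h : ev h \in Aint.
  by apply: rpred_horner zA; apply/polyOverP => i; rewrite coef_map Aint_int.
have q0 : ev ('X^q - 1) = 0.
  by rewrite evB /ev map_polyXn rmorph1 !hornerE zq subrr.
have dE : (p%:R : algC) * (ev e * ev g ^+ q) = (- f.[1])%:~R ^+ q.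
  have <- : ev (f - f.[1]%:P) = (- f.[1])%:~R.
    by rewrite evB {1}/ev (rootP fz) sub0r /ev map_polyC hornerC rmorphN.
  have -> : (p%:R : algC) * (ev e * ev g ^+ q) = ev (p%:Z *: e) * ev g ^+ q.
    by rewrite mulrA /ev map_polyZ hornerZ.
  by rewrite -eE evB q0 subr0 evX -exprMn mulrC -evM -gE.
have /intrP[y yE] : ev e * ev g ^+ q \is a Num.int.
  have p0 : (p%:R : algC) != 0 by rewrite pnatr_eq0 -lt0n prime_gt0.
  apply: Cint_rat_Aint; last by rewrite rpredM ?rpredX.
  rewrite -[_ * _](mulKf p0) dE rpredM ?rpredV ?rpredX //.
    by rewrite rpred_nat.
  by rewrite rpred_int.
move: dE; rewrite yE -rmorphXn -[p%:R]/((p%:Z)%:~R) -intrM => /intr_inj.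
move/(congr1 (intr : int -> 'F_p)).
rewrite intrM rmorphXn -[(p%:Z)%:~R]/(p%:R) pchar_Fp_0 // mul0r.
by move/esym/eqP; rewrite expf_eq0 rmorphN oppr_eq0 => /andP[_ /eqP].
Qed.

Lemma unitmx_mxsub_rank (F : fieldType) (m n : nat) (A : 'M[F]_(m, n)) :
  exists f : 'I_(\rank A) -> 'I_m, exists g : 'I_(\rank A) -> 'I_n,
    mxsub f g A \in unitmx.
Proof.
exists (maxrankfun A).
have rA := maxrowsub_free A; set B := rowsub _ A in rA.
have rBT : row_full B^T by rewrite /row_full mxrank_tr.
exists (fullrankfun rBT); rewrite -unitmx_tr.
have := fullrowsub_unit rBT.
rewrite (_ : rowsub _ _ = (mxsub (maxrankfun A) (fullrankfun rBT) A)^T) //.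
by apply/matrixP => i j; rewrite !mxE.
Qed.

(** A maximal minor of the matrix modulo [p] comes from a determinant in [Z[X]]; were it zero at
    [z], its value at 1 would vanish modulo [p]. *)
Lemma rank_specialization (p k r m n : nat) (z : algC) (B : 'M[{poly int}]_(m, n)) :
  prime p -> z ^+ (p ^ k) = 1 ->
  (\rank (map_mx (fun f : {poly int} => (map_poly intr f).[z]) B) <= r)%N ->
  (\rank (map_mx (fun f : {poly int} => (f.[1])%:~R : 'F_p) B) <= r)%N.
Proof.
move=> p_prime zq; set Bz := map_mx _ B; set Bp := map_mx _ B.
apply: leq_trans; have [f [g]] := unitmx_mxsub_rank _ _ _ Bp.
rewrite unitmxE unitfE => dp.
suff dz : \det (mxsub f g Bz) != 0.
  have : mxsub f g Bz \in unitmx by rewrite unitmxE unitfE.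
  rewrite -row_full_unit => /eqP <-.
  rewrite -[in mxsub _ _ _](mulmx1 Bz) mxsub_mul rowsubE.
  exact: leq_trans (mxrankM_maxl _ _) (mxrankM_maxr _ _).
set d := \det (mxsub f g B).
have dzE : \det (mxsub f g Bz) = (map_poly intr d).[z].
  rewrite -[RHS]/(horner_eval z (map_poly intr d)) /d -!det_map_mx.
  by congr (\det _); apply/matrixP => i j; rewrite !mxE.
have dpE : \det (mxsub f g Bp) = (d.[1])%:~R.
  rewrite -[d.[1]]/(horner_eval 1 d) /d -!det_map_mx.
  by congr (\det _); apply/matrixP => i j; rewrite !mxE.
apply: contra dp; rewrite dzE dpE => dz.
by rewrite (horner1_eq0_of_root_unity _ _ _ _ p_prime zq).
Qed.

(** * A small Kakeya set over [Z/p^k] *)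

Lemma Zp_order (p k : nat) : prime p -> (0 < k)%N ->
  (Zp_trunc (p ^ k)).+2 = (p ^ k)%N.
Proof.
by move=> p_prime k_gt0; rewrite Zp_cast // -{1}(expn0 p) ltn_exp2l // prime_gt1.
Qed.

(* For [e = 1] the slopes [c] are exactly the non-units, which saves one more
   factor [p]; [kakeya_set] needs this for the coordinates before the first unit. *)
Lemma slope_function_Zp (p k s : nat) : prime p ->
  k = (\sum_(i < s) p ^ i.+1).+1 ->
  exists a : 'Z_(p ^ k) -> 'Z_(p ^ k), forall (t : 'Z_(p ^ k)) (e : nat),
    (e <= 1)%N ->
    (#|[set (a c + t * c)%R | c : 'Z_(p ^ k) & (p ^ e %| c)%N]|
      <= p ^ (k - s - e))%N.
Proof.
move=> p_prime kE; have p_gt0 := prime_gt0 p_prime.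
have k_gt0 : (0 < k)%N by rewrite kE.
have qE := Zp_order _ _ p_prime k_gt0.
have [a aP] := slope_function _ _ _ p_prime kE.
exists (fun c => (a c)%:R) => t e e1.
have [j0 [j0_gt0 j0s] [G GP]] := aP t.
set M := (j0 + s)%N in j0s GP.
(* A value is determined by its [k - M] digits above [M] and by the low [j0] digits of [c], of which
   the first [e] are zero: [k - s - e] free digits. *)
pose g (x : 'I_(p ^ (k - M)) * 'I_(p ^ (j0 - e))) : 'Z_(p ^ k) :=
  (x.1 * p ^ M + G (p ^ e * x.2)%N %% p ^ M)%:R.
apply: leq_trans (_ : #|[set g x | x in setT]| <= _)%N; last first.
  apply: leq_trans (leq_imset_card _ _) _.
  rewrite cardsT card_prod !card_ord -expnD leq_exp2l ?prime_gt1 //.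
  by rewrite /M; lia.
apply: subset_leq_card; apply/subsetP => y0 /imsetP[c]; rewrite inE => pc ->.
have cq : (c < p ^ k)%N by apply: leq_trans (ltn_ord c) _; rewrite qE.
set y := (a c + t * c)%N.
have yE : (a c)%:R + t * c = (y %% p ^ k)%:R :> 'Z_(p ^ k).
  rewrite Zp_nat_mod /y ?natrD ?natrM ?natr_Zp //.
  by rewrite -{1}(expn0 p) ltn_exp2l // prime_gt1.
have x1 : (y %% p ^ k %/ p ^ M < p ^ (k - M))%N.
  rewrite ltn_divLR ?expn_gt0 ?p_gt0 // -expnD subnK //.
  by rewrite ltn_pmod // expn_gt0 p_gt0.
have x2 : (c %% p ^ j0 %/ p ^ e < p ^ (j0 - e))%N.
  rewrite ltn_divLR ?expn_gt0 ?p_gt0 // -expnD subnK ?ltn_pmod ?expn_gt0 ?p_gt0 //.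
  by lia.
apply/imsetP; exists (Ordinal x1, Ordinal x2); rewrite ?inE // yE /g /=.
congr (_%:R); rewrite [LHS](divn_eq _ (p ^ M)); congr (_ + _)%N.
rewrite modn_dvdm ?dvdn_exp2l // GP // [(p ^ e * _)%N]mulnC divnK //.
by rewrite /dvdn modn_dvdm // dvdn_exp2l //; lia.
Qed.

Lemma dvdn_Zp_nonunit (p k : nat) (x : 'Z_(p ^ k)) : prime p -> (0 < k)%N ->
  x \isn't a GRing.unit -> (p %| x)%N.
Proof.
move=> p_prime k_gt0; rewrite -{1}(natr_Zp x) unitZpE.
  by rewrite coprime_pexpl // prime_coprime // negbK.
by rewrite -{1}(expn0 p) ltn_exp2l // prime_gt1.
Qed.

Lemma card_rV_family (T : finType) (n : nat) (F : 'I_n -> {set T}) :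
  #|[set x : 'rV[T]_n | [forall j, x 0 j \in F j]]| = (\prod_j #|F j|)%N.
Proof.
have <- : foldr muln 1%N [seq #|F j| | j : 'I_n] = (\prod_j #|F j|)%N.
  by rewrite foldrE big_map big_enum.
rewrite -card_family -(card_imset _ (f := fun x : 'rV[T]_n => [ffun j => x 0 j])).
  apply: eq_card => f; apply/imsetP/familyP => [[x + ->] j|fF].
    by rewrite inE ffunE => /forallP.
  exists (\row_j f j); last by apply/ffunP => j; rewrite ffunE mxE.
  by rewrite inE; apply/forallP => j; rewrite mxE fF.
by move=> x y /ffunP xy; apply/rowP => j; have := xy j; rewrite !ffunE.
Qed.

Lemma sum_lt_ord (n : nat) (i : 'I_n) : (\sum_(j < n | j != i) (j < i) = i)%N.
Proof.
have -> : (\sum_(j < n | j != i) (j < i) = \sum_(j < n) (j < i))%N.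
  by rewrite [RHS](bigD1 i) //= ltnn.
rewrite -(big_mkord xpredT (fun j => nat_of_bool (j < i)%N)).
rewrite (@big_cat_nat _ _ _ i) //=; last exact: ltnW.
rewrite [X in (_ + X)%N]big_nat [X in (_ + X)%N]big1 => [|j /andP[ij _]].
  rewrite addn0 big_nat (eq_bigr (fun=> 1%N)) => [|j /= ->//].
  by rewrite -big_nat sum_nat_const_nat muln1 subn0.
by rewrite ltnNge ij.
Qed.

Lemma leq_sum_expn (p s : nat) : (0 < p)%N -> (s <= \sum_(i < s) p ^ i.+1)%N.
Proof.
move=> p_gt0; rewrite -{1}(card_ord s) -sum1_card leq_sum // => i _.
by rewrite expn_gt0 p_gt0.
Qed.

Lemma kakeya_set (p k s n : nat) : prime p ->
  k = (\sum_(i < s) p ^ i.+1).+1 ->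
  exists2 S : {set 'rV['Z_(p ^ k)]_n},
    (#|S| <= \sum_(i < n) p ^ (k + (k - s) * n.-1 - i))%N &
    forall b, b \in has_unit_coord 'Z_(p ^ k) n ->
      exists a, forall t : 'Z_(p ^ k), a + t *: b \in S.
Proof.
move=> p_prime kE; have k_gt0 : (0 < k)%N by rewrite kE.
have ks : (1 <= k - s)%N.
  by rewrite kE subn_gt0 ltnS leq_sum_expn // prime_gt0.
have [a aP] := slope_function_Zp _ _ _ p_prime kE.
pose E (t : 'Z_(p ^ k)) (e : nat) : {set 'Z_(p ^ k)} :=
  [set a c + t * c | c : 'Z_(p ^ k) & (p ^ e %| c)%N].
(* [S i] serves the directions with first unit coordinate [i]: the parameter is [x 0 i], and the
   slopes before position [i] are non-units. *)
pose S i := [set x : 'rV['Z_(p ^ k)]_n |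
  [forall j, (j != i) ==> (x 0 j \in E (x 0 i) (j < i)%N)]].
have cardS i : (#|S i| <= p ^ (k + (k - s) * n.-1 - i))%N.
  rewrite -sum1_card (partition_big (fun x : 'rV_n => x 0 i) xpredT) //=.
  apply: (@leq_trans (\sum_(t : 'Z_(p ^ k)) p ^ ((k - s) * n.-1 - i))).
    apply: leq_sum => t _; rewrite sum1dep_card.
    pose F j := if j == i then [set t] else E t (j < i)%N.
    apply: (@leq_trans #|[set x : 'rV_n | [forall j, x 0 j \in F j]]|).
      apply/subset_leq_card/subsetP => x; rewrite !inE => /andP[/forallP xS /eqP xt].
      apply/forallP => j; rewrite /F; case: eqVneq => [->|ji]; first by rewrite xt set11.
      by have := xS j; rewrite ji xt.
    rewrite card_rV_family (bigD1 i) //= {1}/F eqxx cards1 mul1n.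
    apply: (@leq_trans (\prod_(j < n | j != i) p ^ (k - s - (j < i)))).
      apply: leq_prod => j ji; rewrite /F (negPf ji); apply: aP.
      by case: (j < i)%N.
    rewrite -expn_sum leq_exp2l ?prime_gt1 // sumnB => [|j _]; last first.
      by apply: leq_trans ks; case: (j < i)%N.
    by rewrite sum_lt_ord sum_nat_const cardC1 card_ord mulnC.
  rewrite sum_nat_const card_ord Zp_order // -expnD leq_exp2l ?prime_gt1 //.
  (* The truncated subtraction is exact, because [i <= n.-1 <= (k - s) * n.-1]. *)
  rewrite addnBA //; apply: leq_trans (leq_pmull _ ks).
  by have := ltn_ord i; lia.
exists (\bigcup_i S i) => [|b].
  apply: (@leq_trans (\sum_i #|S i|)); last by apply: leq_sum.
  elim/big_ind2: _ => [|A u B v Au Bv|//]; first by rewrite cards0.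
  by apply: leq_trans (leq_add Au Bv); rewrite cardsU leq_subr.
rewrite inE => /existsP[i0 ui0].
have [i ui min_i] := @arg_minnP _ i0 (fun i => b 0 i \is a GRing.unit) val ui0.
(* Normalizing [b] to have entry 1 at [i] gives the slopes [b_j / b_i] and replaces the parameter
   [t] by [t * b_i]. *)
exists (\row_j if j == i then 0 else a ((b 0 i)^-1 * b 0 j)) => t.
apply/bigcupP; exists i => //; rewrite inE; apply/forallP => j; apply/implyP => ji.
rewrite !mxE eqxx (negPf ji) add0r; apply/imsetP; exists ((b 0 i)^-1 * b 0 j).
  rewrite inE; case: ltnP => [ltji|_]; last by rewrite dvd1n.
  rewrite expn1 dvdn_Zp_nonunit // unitrM unitrV ui /=.
  by apply/negP => /min_i; rewrite leqNgt ltji.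
by rewrite -mulrA mulVKr.
Qed.

(** * Characters of [Z/p^k] and the rank bound *)

Lemma exprZpD (q : nat) (z : algC) (x y : 'Z_q) : z ^+ (Zp_trunc q).+2 = 1 ->
  z ^+ (x + y)%R = z ^+ x * z ^+ y.
Proof. by move=> zq; rewrite -exprD /= expr_mod. Qed.

(** Translating [t] by 1 multiplies the sum by [z ^+ m], which differs from 1 when [m] is
    nonzero. *)
Lemma sum_exprZp (q : nat) (z : algC) (m : 'Z_q) :
  ((Zp_trunc q).+2).-primitive_root z ->
  \sum_(t : 'Z_q) z ^+ (t * m)%R = (m == 0)%:R * (Zp_trunc q).+2%:R.
Proof.
move=> pz; have zq := prim_expr_order pz.
case: eqVneq => [->|m0].
  under eq_bigr => t _ do rewrite mulr0 expr0.
  by rewrite sumr_const card_ord mul1r.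
rewrite mul0r; set X := \sum_t _.
have XE : z ^+ m * X = X.
  rewrite {2}/X (reindex_inj (addrI 1)) mulr_sumr; apply: eq_bigr => t _.
  by rewrite mulrDl mul1r exprZpD.
have : (z ^+ m - 1) * X = 0 by rewrite mulrBl mul1r XE subrr.
move/eqP; rewrite mulf_eq0 subr_eq0 => /predU1P[|/eqP//].
move/eqP; rewrite -(prim_order_dvd pz) => /dvdn_leq.
have m_gt0 : (0 < m)%N by rewrite lt0n.
by move/(_ m_gt0); rewrite leqNgt ltn_ord.
Qed.

Lemma inner_line (R : finComUnitRingType) (n : nat) (a b u : 'rV[R]_n) (t : R) :
  inner (a + t *: b) u = inner a u + t * inner b u.
Proof.
rewrite /inner mulr_sumr -big_split; apply: eq_bigr => i _.
by rewrite !mxE mulrDl mulrA.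
Qed.

Lemma rank_le_kakeya (p k n : nat) (P S : {set 'rV['Z_(p ^ k)]_n}) :
  prime p -> (0 < k)%N ->
  (forall b, b \in P -> exists a, forall t : 'Z_(p ^ k), a + t *: b \in S) ->
  (rank_mod p (incidence_mx P) <= #|S|)%N.
Proof.
move=> p_prime k_gt0 lineS.
have qE := Zp_order _ _ p_prime k_gt0.
have [a aP] : exists a : 'rV_n -> 'rV_n, forall b t, b \in P -> a b + t *: b \in S.
  apply: (fin_all_exists (P := fun b x => forall t, b \in P -> x + t *: b \in S)).
  move=> b; have [bP|_] := boolP (b \in P); last by exists 0.
  by have [x xP] := lineS b bP; exists x.
have [z pz] := C_prim_root_exists (isT : (0 < (Zp_trunc (p ^ k)).+2)%N).
have zq := prim_expr_order pz.
pose B : 'M[{poly int}]_(#|setX P [set: 'Z_(p ^ k)]|, #|[set: 'rV['Z_(p ^ k)]_n]|) :=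
  \matrix_(r, c) let bl := enum_val r in let u := enum_val c in
    (inner bl.1 u == bl.2)%:R * 'X^(inner (a bl.1) u).
have -> : rank_mod p (incidence_mx P) =
    \rank (map_mx (fun f : {poly int} => (f.[1])%:~R : 'F_p) B).
  congr (\rank _); apply/matrixP => r c; rewrite !mxE /=.
  by rewrite hornerM hornerXn expr1n mulr1 -polyC_natr hornerC.
apply: (rank_specialization p k _ _ _ z) => //; first by rewrite -qE.
set Bz := map_mx _ B.
pose C := \matrix_(r < #|setX P [set: 'Z_(p ^ k)]|, x < #|S|)
  let bl := enum_val r in
  \sum_(t : 'Z_(p ^ k) | a bl.1 + t *: bl.1 == enum_val x) z ^+ (- (t * bl.2))%R.
pose D := \matrix_(x < #|S|, c < #|[set: 'rV['Z_(p ^ k)]_n]|)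
  z ^+ (inner (enum_val x) (enum_val c)).
have BE : ((Zp_trunc (p ^ k)).+2)%:R *: Bz = C *m D.
  apply/matrixP => r c; rewrite !mxE /=.
  set b := (enum_val r).1; set l := (enum_val r).2; set u := enum_val c.
  have bP : b \in P by have := enum_valP r; rewrite inE => /andP[].
  rewrite rmorphM /= map_polyXn rmorph_nat hornerM hornerXn -polyC_natr hornerC.
  (* Orthogonality turns the indicator into a sum over [t], to be matched with the sum over the
     points of the line. *)
  have -> : (inner b u == l) = (inner b u - l == 0) by rewrite subr_eq0.
  rewrite mulrA [_%:R * _]mulrC -(sum_exprZp _ _ _ pz) mulr_suml.
  under [RHS]eq_bigr => x _ do rewrite !mxE -/b -/l mulr_suml.
  rewrite (exchange_big_dep xpredT) //; apply: eq_bigr => t _.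
  have tS := aP b t bP.
  (* For fixed [t], exactly one index of [S] carries the point [a b + t *: b]. *)
  rewrite (bigD1 (enum_rank_in tS (a b + t *: b))) ?enum_rankK_in ?eqxx //.
  rewrite big1 => [|x /andP[/eqP xE /negP[]]]; last first.
    by apply/eqP/enum_val_inj; rewrite enum_rankK_in // xE.
  rewrite Monoid.mulm1 inner_line -!exprZpD //; congr (z ^+ _); congr (nat_of_ord _).
  by ring.
have q0 : ((Zp_trunc (p ^ k)).+2)%:R != 0 :> algC by rewrite pnatr_eq0.
rewrite -(eqmx_scale Bz q0) BE; exact: leq_trans (mxrankM_maxl _ _) (rank_leq_col _).
Qed.

(** * The numerical estimate *)

Lemma geometric_ratio_nat (p k s : nat) : (1 < p)%N ->
  k%:R = (p%:R ^+ s.+1 - 1) / (p%:R - 1) :> rat ->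
  k = (\sum_(i < s) p ^ i.+1).+1.
Proof.
move=> p_gt1 kE; apply/eqP; rewrite -(eqr_nat rat) kE.
have p1 : p%:R - 1 != 0 :> rat by rewrite subr_eq0 -[1]/(1%:R) eqr_nat gtn_eqF.
rewrite subrX1 mulrAC mulfV // mul1r big_ord_recl expr0 -nat1r natr_sum.
by apply/eqP; congr (_ + _); apply: eq_bigr => i _; rewrite natrX.
Qed.

(** With [v = 1 - 1/p], [k * v = p^s - 1/p <= p^s]; this is used [n - 1] times. The remaining factor
    [1/v] bounds the geometric sum over [i]. *)
Lemma kakeya_size_bound (p k n s : nat) : (1 < p)%N -> (0 < k)%N -> (0 < n)%N ->
  (s < k)%N ->
  k%:R = (p%:R ^+ s.+1 - 1) / (p%:R - 1) :> rat ->
  (\sum_(i < n) p ^ (k + (k - s) * n.-1 - i))%N%:R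
    <= p%:R ^+ (k * n) / k%:R ^+ (n - 1) * (1 - p%:R^-1) ^- n :> rat.
Proof.
move=> p_gt1 k_gt0 n_gt0 sk kE.
have p0 : 0 < p%:R :> rat by rewrite ltr0n ltnW.
have pu : p%:R != 0 :> rat by rewrite gt_eqF.
have p1 : 0 < p%:R - 1 :> rat by rewrite subr_gt0 ltr1n.
set v : rat := 1 - p%:R^-1.
have v0 : 0 < v by rewrite subr_gt0 invf_lt1 // ltr1n.
have kv : k%:R * v <= p%:R ^+ s.
  have -> : k%:R * v = p%:R ^+ s - p%:R^-1.
    by rewrite kE /v exprS; field; rewrite pu gt_eqF.
  by rewrite gerBl invr_ge0 ltW.
set N := (k + (k - s) * n.-1)%N.
have -> : (\sum_(i < n) p ^ (N - i))%N%:R = p%:R ^+ N * \sum_(i < n) p%:R^-1 ^+ i :> rat.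
  rewrite natr_sum mulr_sumr; apply: eq_bigr => i _.
  rewrite natrX exprVn expfB_cond // (negPf pu) add0n (leq_trans _ (leq_addl _ _)) //.
  by apply: leq_trans (leq_pmull _ _); [have := ltn_ord i; lia | rewrite subn_gt0].
have sv : \sum_(i < n) p%:R^-1 ^+ i <= v^-1 :> rat.
  rewrite -[v^-1]mul1r ler_pdivlMr // mulrC /v -opprB mulNr -subrX1 opprB.
  by rewrite gerBl exprn_ge0 // invr_ge0 ltW.
apply: le_trans (ler_wpM2l _ sv) _; first by rewrite exprn_ge0 // ltW.
have -> : v ^- n = v ^- n.-1 * v^-1 by rewrite -{1}(prednK n_gt0) exprSr invfM mulrC.
rewrite mulrA ler_pM2r ?invr_gt0 //.
rewrite subn1 -mulrA -invfM -exprMn ler_pdivlMr ?exprn_gt0 ?mulr_gt0 ?ltr0n //.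
have kvn : (k%:R * v) ^+ n.-1 <= (p%:R ^+ s) ^+ n.-1 :> rat.
  by rewrite lerXn2r // nnegrE ?exprn_ge0 ?mulr_ge0 ?ler0n ?(ltW v0).
apply: le_trans (ler_wpM2l _ kvn) _; first by rewrite exprn_ge0 // ltW.
rewrite -exprM -exprD le_eqVlt; apply/orP; left; apply/eqP; congr (_ ^+ _).
have -> : (k * n = k + k * n.-1)%N by rewrite -mulnS prednK.
rewrite /N mulnBl.
have : (s * n.-1 <= k * n.-1)%N by rewrite leq_mul2r (ltnW sk) orbT.
lia.
Qed.

Theorem theorem2 (p k n s : nat) (p_prime : prime p) (k_ge1 : (1 <= k)%N)
  (n_ge1 : (1 <= n)%N)
  (k_def : k%:R = (p%:R ^+ s.+1 - 1) / (p%:R - 1) :> rat)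
  (P : {set 'rV['Z_(p ^ k)]_n}) (P_repr : proj_representatives P) :
  (rank_mod p (incidence_mx P))%:R
    <= p%:R ^+ (k * n) / k%:R ^+ (n - 1) * (1 - p%:R^-1) ^- n :> rat.
Proof.
have p_gt1 := prime_gt1 p_prime.
have kE := geometric_ratio_nat _ _ _ p_gt1 k_def.
have [S cardS lineS] := kakeya_set p k s n p_prime kE.
have rankS : (rank_mod p (incidence_mx P) <= #|S|)%N.
  apply: rank_le_kakeya => // b bP; apply: lineS.
  by case/and3P: P_repr => _ /subsetP PU _; apply: PU.
have sk : (s < k)%N by rewrite kE ltnS leq_sum_expn // ltnW.
apply: le_trans (kakeya_size_bound _ _ _ _ p_gt1 k_ge1 n_ge1 sk k_def).
by rewrite ler_nat (leq_trans rankS).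
Qed.
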